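(* Let $X,Y$ be Banach spaces, $f\colon X\to\mathbb R$ and $G\colon X\to Y$ continuously Fréchet differentiable, $q\colon X\to\mathbb R\cup\{+\infty\}$ lower semicontinuous, and $C\subset X$, $K\subset Y$ nonempty and closed. Let $\mathcal S:=\{x\in C\mid G(x)\in K\}$ and let $\bar x\in\mathcal S\cap\operatorname{dom}q$ satisfy the uniform qualification condition. If $\bar x$ is an approximately stationary point of the problem $\min\{f(x)+q(x)\mid G(x)\in K,\ x\in C\}$, then it is an M-stationary point of this problem.
   Context: $B_\varepsilon(x)$ is the open ball, $\mathbb B$, $\mathbb B^*$ the open unit balls of primal and dual spaces; $G'(x)^*$ is the adjoint of $G'(x)$; $\operatorname{dom}q=\{x\mid q(x)<+\infty\}$; products carry the maximum norm. For $\Omega\subset X$, $\bar x\in\Omega$, $\varepsilon\ge0$: $N_{\Omega,\varepsilon}(\bar x)=\{x^*\mid\limsup_{x\to\bar x,\,x\in\Omega\setminus\{\bar x\}}\langle x^*,x-\bar x\rangle/\|x-\bar x\|\le\varepsilon\}$. The Fréchet normal cone is $N_\Omega(\bar x):=N_{\Omega,0}(\bar x)$. The limiting normal cone $\overline N_\Omega(\bar x)$ is the set of all $x^*\in X^*$ for which there are sequences $x_k\to\bar x$ in $\Omega$, $\varepsilon_k\downarrow0$, and $x_k^*\in N_{\Omega,\varepsilon_k}(x_k)$ with $x_k^*\to x^*$ weakly$^*$. Both cones are empty at points outside $\Omega$. The Fréchet subdifferential is $\partial q(\bar x)=\{x^*\mid(x^*,-1)\in N_{\operatorname{epi}q}(\bar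 x,q(\bar x))\}$ (equivalently, $\liminf_{x\to\bar x,\,x\neq\bar x}(q(x)-q(\bar x)-\langle x^*,x-\bar x\rangle)/\|x-\bar x\|\ge0$), and the limiting subdifferential is $\overline\partial q(\bar x)=\{x^*\mid(x^*,-1)\in\overline N_{\operatorname{epi}q}(\bar x,q(\bar x))\}$, both empty outside $\operatorname{dom}q$. Approximate stationarity: $\bar x\in\mathcal S\cap\operatorname{dom}q$ is approximately stationary if, for each $\varepsilon>0$, there exist $x,x',x''\in B_\varepsilon(\bar x)$ and $y\in\varepsilon\mathbb B$ such that $|q(x)-q(\bar x)|<\varepsilon$ and $0\in f'(x)+\partial q(x)+G'(x')^*N_K(G(x')-y)+N_C(x'')+\varepsilon\mathbb B^*$. M-stationarity: $\bar x\in\mathcal S\cap\operatorname{dom}q$ is M-stationary if $0\in f'(\bar x)+\overline\partial q(\bar x)+G'(\bar x)^*\overline N_K(G(\bar x))+\overline N_C(\bar x)$. Uniform qualification condition at $\bar x\in\mathcal S\cap\operatorname{dom}q$: $$\limsup_{x\to\bar x,\,x'\to\bar x,\,x''\to\bar x,\,y\to0,\,q(x)\to q(\bar x)}\bigl(\partial q(x)+G'(x')^*N_K(G(x')-y)+N_C(x'')\bigr)\subset\overline\partial q(\bar x)+G'(\bar x)^*\overline N_K(G(\bar x))+\overline N_C(\bar x),$$ where $\limsup$ is the strong (norm) outer limit: the set of all $x^*\in X^*$ for which there are sequences $x_k,x_k',x_k''\to\bar x$, $y_k\to0$ with $q(x_k)\to q(\bar x)$, and $x_k^*\in\partial q(x_k)+G'(x_k')^*N_K(G(x_k')-y_k)+N_C(x_k'')$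 with $x_k^*\to x^*$ in norm. *)

(* Defs.v *)
From HB Require Import structures.
From mathcomp Require Import all_boot all_order all_algebra.
From mathcomp Require Import all_classical all_reals all_analysis.

Set Implicit Arguments.
Unset Strict Implicit.
Unset Printing Implicit Defensive.

Import Order.TTheory GRing.Theory Num.Theory.
Import numFieldNormedType.Exports.

Local Open Scope classical_set_scope.
Local Open Scope ring_scope.

Section DualSpace.
Context {R : realType}.

(* The library has no type of continuous linear functionals: elements of X^*
   are functions X -> R lying in [dual_space X], and subsets of X^* are sets of
   such functions, added pointwise. *)
Definition dual_space (X : normedModType R) : set (X -> R) :=
  [set xs : X -> R | scalar xs /\ continuous xs].

(* This is the operator norm only for a bounded linear L: [sup] of an unbounded
   set is 0. *)
Definition op_norm {V W : normedModType R} (L : V -> W) : R :=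
  sup [set `|L h| | h in [set h : V | `|h| <= 1]].

Definition dual_ball (X : normedModType R) (r : R) : set (X -> R) :=
  [set xs | dual_space xs /\ op_norm xs < r].

Definition minkowski_sum {V : zmodType} (A B : set V) : set V :=
  [set a + b | a in A & b in B].

Definition continuously_differentiable {V W : normedModType R} (F : V -> W) : Prop :=
  (forall x, differentiable F x) /\
  (forall x, op_norm ('d F z \- 'd F x) @[z --> x] --> (0 : R)).

Definition adjoint {V W : Type} (L : V -> W) (ys : W -> R) : V -> R := ys \o L.

End DualSpace.

Notation "A `(+)` B" := (minkowski_sum A B)
  (at level 50, left associativity) : classical_set_scope.

Section NormalCones.
Context {R : realType} {X : normedModType R}.

(* At an isolated point of Om the filter below is improper and the upper limit
   is -oo, so that every functional is normal there. *)
Definition eps_normal (Om : set X) (e : R) (xbar : X) : set (X -> R) :=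
  [set xs | [/\ dual_space xs, Om xbar &
    (limf_esup (fun x => (xs (x - xbar) / `|x - xbar|)%:E)
       (within (Om `\ xbar) (nbhs xbar)) <= e%:E)%E]].

Definition frechet_normal (Om : set X) (xbar : X) : set (X -> R) :=
  eps_normal Om 0 xbar.

(* [e_ k] decreasing to 0 is read as positive and tending to 0; weak* convergence
   of [xs_] is pointwise convergence on X. *)
Definition limiting_normal (Om : set X) (xbar : X) : set (X -> R) :=
  [set xs | [/\ dual_space xs, Om xbar &
    exists (x_ : nat -> X) (e_ : nat -> R) (xs_ : nat -> X -> R),
      [/\ forall k, Om (x_ k),
          x_ k @[k --> \oo] --> xbar,
          forall k, 0 < e_ k,
          e_ k @[k --> \oo] --> (0 : R) &
          (forall k, eps_normal Om (e_ k) (x_ k) (xs_ k)) /\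
          (forall h, xs_ k h @[k --> \oo] --> xs h)]]].

End NormalCones.

Section Subdifferentials.
Context {R : realType} {X : normedModType R}.

Definition edom (q : X -> \bar R) : set X := [set x | (q x < +oo)%E].

Definition epigraph (q : X -> \bar R) : set (X * R) :=
  [set p | (q p.1 <= p.2%:E)%E].

(* (X * R)^* is identified with X^* * R; this is the functional (xs, a). *)
Definition pair_functional (xs : X -> R) (a : R) : X * R -> R :=
  fun p => xs p.1 + a * p.2.

(* The space X * R carries the library's product norm, which is the maximum
   norm. *)
Definition frechet_subdiff (q : X -> \bar R) (xbar : X) : set (X -> R) :=
  [set xs | [/\ dual_space xs, edom q xbar &
    frechet_normal (epigraph q) (xbar, fine (q xbar))
      (pair_functional xs (-1))]].

Definition limiting_subdiff (q : X -> \bar R) (xbar : X) : set (X -> R) :=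
  [set xs | [/\ dual_space xs, edom q xbar &
    limiting_normal (epigraph q) (xbar, fine (q xbar))
      (pair_functional xs (-1))]].

End Subdifferentials.

Section Stationarity.
Context {R : realType} {X Y : normedModType R}.
Variables (f : X -> R) (q : X -> \bar R) (G : X -> Y) (K : set Y) (C : set X).

Definition feasible_set : set X := [set x | C x /\ K (G x)].

Definition frechet_sum (x x' x'' : X) (y : Y) : set (X -> R) :=
  frechet_subdiff q x
  `(+)` adjoint ('d G x') @` frechet_normal K (G x' - y)
  `(+)` frechet_normal C x''.

Definition limiting_sum (xbar : X) : set (X -> R) :=
  limiting_subdiff q xbar
  `(+)` adjoint ('d G xbar) @` limiting_normal K (G xbar)
  `(+)` limiting_normal C xbar.

Definition approximately_stationary (xbar : X) : Prop :=
  (feasible_set `&` edom q) xbar /\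
  forall e : R, 0 < e ->
    exists (x x' x'' : X) (y : Y),
      [/\ [/\ ball xbar e x, ball xbar e x' & ball xbar e x''],
          ball 0 e y,
          (`|q x - q xbar| < e%:E)%E &
          ([set 'd f x : X -> R] `(+)` frechet_sum x x' x'' y `(+)` dual_ball e)
            (0 : X -> R)].

Definition M_stationary (xbar : X) : Prop :=
  (feasible_set `&` edom q) xbar /\
  ([set 'd f xbar : X -> R] `(+)` limiting_sum xbar) (0 : X -> R).

Definition frechet_sum_outer_limit (xbar : X) : set (X -> R) :=
  [set xs | dual_space xs /\
    exists (x_ x'_ x''_ : nat -> X) (y_ : nat -> Y) (xs_ : nat -> X -> R),
      [/\ [/\ x_ k @[k --> \oo] --> xbar,
              x'_ k @[k --> \oo] --> xbar &
              x''_ k @[k --> \oo] --> xbar],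
          y_ k @[k --> \oo] --> (0 : Y),
          q (x_ k) @[k --> \oo] --> q xbar,
          forall k, frechet_sum (x_ k) (x'_ k) (x''_ k) (y_ k) (xs_ k) &
          op_norm (xs_ k \- xs) @[k --> \oo] --> (0 : R)]].

Definition uniform_qualification (xbar : X) : Prop :=
  frechet_sum_outer_limit xbar `<=` limiting_sum xbar.

End Stationarity.

(* Main.v *)
From HB Require Import structures.
Require Import Defs.
From mathcomp Require Import all_boot all_order all_algebra.
From mathcomp Require Import all_classical all_reals all_analysis.
From mathcomp Require Import ring.
Import Order.TTheory GRing.Theory Num.Theory.
Import numFieldNormedType.Exports.
Local Open Scope classical_set_scope.
Local Open Scope ring_scope.

(** Approximate stationarity with radius [1 / (k + 1)] gives
    [0 = f'(x_k) + s_k + u_k] with [s_k] in the sum of the Fréchet cones and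
    [u_k] of norm less than [1 / (k + 1)].  Since [f'] is continuous,
    [s_k = - f'(x_k) - u_k] tends to [- f'(xbar)] in norm, so [- f'(xbar)] lies
    in the outer limit and hence, by the qualification condition, in the sum of
    the limiting cones. *)

Lemma cvg_ball_natSinv {R : realType} {T : pseudoMetricType R} (u : nat -> T)
    (a : T) :
  (forall k, ball a k.+1%:R^-1 (u k)) -> u k @[k --> \oo] --> a.
Proof.
move=> u_near; apply/cvg_ballP => e e0.
near=> k; apply: le_ball (u_near k); apply: ltW.
by near: k; exact: (near_infty_natSinv_lt (PosNum e0)).
Unshelve. all: by end_near. Qed.

Section OpNorm.
Context {R : realType} {X : normedModType R}.
Implicit Types xs ys : X -> R.

(** [op_norm] is a [sup], which defaults to 0 on an unbounded set, so it dominates the values on the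
    unit ball only once these are known to be bounded. Continuity at 0 together with linearity
    supplies the bound. *)
Lemma dual_space_has_sup xs :
  dual_space xs -> has_sup [set `|xs h| | h in [set h : X | `|h| <= 1]].
Proof.
move=> [xs_lin xs_cont]; split.
  by exists `|xs 0|; exists 0 => //=; rewrite normr0.
pose L := GRing.isLinear.Build R X R _ xs xs_lin.
pose g : {linear X -> R} := HB.pack xs L.
have /linear_boundedP : bounded_near g (nbhs (0 : X)).
  by apply: continuous_linear_bounded; exact: xs_cont.
(* The estimate [|xs h| <= c * |h|] is available for every [c] strictly above [r], whence [r + 1].
   The maximum with 0 makes [c] nonnegative, so that [|h| <= 1] gives [c * |h| <= c]. *)
move=> [r [_ xs_le]]; exists (Num.max (r + 1) 0) => _ [h /= h1 <-].
have r_lt : r < Num.max (r + 1) 0 by rewrite lt_max ltrDl ltr01.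
apply: le_trans (xs_le _ r_lt h) _.
by rewrite ler_piMr// le_max lexx orbT.
Qed.

Lemma ler_op_norm xs h : dual_space xs -> `|h| <= 1 -> `|xs h| <= op_norm xs.
Proof.
move=> /dual_space_has_sup xs_sup h1.
by apply: sup_upper_bound => //; exists h.
Qed.

Lemma op_norm_ge0 xs : dual_space xs -> 0 <= op_norm xs.
Proof.
move=> xs_dual; apply: le_trans (@ler_op_norm xs 0 xs_dual _) => //.
by rewrite normr0.
Qed.

Lemma op_norm_le xs (r : R) :
  (forall h, `|h| <= 1 -> `|xs h| <= r) -> op_norm xs <= r.
Proof.
move=> xs_le; apply: ge_sup => [|_ [h /= h1 <-]]; last exact: xs_le.
by exists `|xs 0|; exists 0 => //=; rewrite normr0.
Qed.

Lemma dual_spaceD xs ys :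
  dual_space xs -> dual_space ys -> dual_space (xs \+ ys).
Proof.
move=> [xs_lin xs_cont] [ys_lin ys_cont]; split=> [a u v|x] /=.
  by rewrite xs_lin ys_lin mulrDr addrACA.
by apply: continuousD; [exact: xs_cont|exact: ys_cont].
Qed.

Lemma dual_spaceN xs : dual_space xs -> dual_space (\- xs).
Proof.
move=> [xs_lin xs_cont]; split=> [a u v|x] /=.
  by rewrite xs_lin opprD mulrN.
by apply: continuousN; exact: xs_cont.
Qed.

Lemma dual_space_diff (f : X -> R) x :
  differentiable f x -> dual_space ('d f x : X -> R).
Proof.
by move=> f_diff; split; [exact: linearP|exact: diff_continuous].
Qed.

End OpNorm.

Theorem proposition6p9 (R : realType) (X Y : completeNormedModType R)
    (f : X -> R) (G : X -> Y) (q : X -> \bar R) (C : set X) (K : set Y)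
    (xbar : X)
    (f_C1 : continuously_differentiable f)
    (G_C1 : continuously_differentiable G)
    (q_not_ninfty : forall x, q x <> -oo%E)
    (q_lsc : lower_semicontinuous q)
    (C_nonempty : C !=set0) (C_closed : closed C)
    (K_nonempty : K !=set0) (K_closed : closed K)
    (xbar_feasible : (feasible_set G K C `&` edom q) xbar)
    (xbar_uqc : uniform_qualification q G K C xbar) :
  approximately_stationary f q G K C xbar -> M_stationary f q G K C xbar.
Proof.
have [f_diff df_cont] := f_C1.
have df_dual x : dual_space ('d f x : X -> R) by exact: dual_space_diff.
move=> [_ xbar_stat]; split=> //.
exists ('d f xbar : X -> R) => //; exists (\- ('d f xbar : X -> R)); last first.
  by apply/funext => h; rewrite /= !fctE subrr.
apply: xbar_uqc; split; first exact: dual_spaceN.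
(* All witnesses for one [k], including the two functionals, are packed into a single tuple, so that
   one use of choice yields sequences that belong together. *)
have {xbar_stat} /choice[z_ z_stat] (k : nat) :
    exists z : (X * X * X * Y) * ((X -> R) * (X -> R)),
    let: (x, x', x'', y, (s, u)) := z in
    [/\ [/\ ball xbar k.+1%:R^-1 x, ball xbar k.+1%:R^-1 x' &
            ball xbar k.+1%:R^-1 x''],
        ball 0 k.+1%:R^-1 y, (`|q x - q xbar| < k.+1%:R^-1%:E)%E,
        frechet_sum q G K C x x' x'' y s &
        dual_ball k.+1%:R^-1 u /\ forall h, 'd f x h + s h + u h = 0].
  have k0 : 0 < k.+1%:R^-1 :> R by rewrite invr_gt0.
  have [x [x' [x'' [y [xs_near y_near qx_near]]]]] := xbar_stat _ k0.
  move=> [_ [_ -> [s s_sum <-]] [u u_ball sum0]].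
  exists (x, x', x'', y, (s, u)); split=> //; split=> // h.
  by rewrite -[RHS]/((0 : X -> R) h) -sum0.
pose x_ k := (z_ k).1.1.1.1.
pose x'_ k := (z_ k).1.1.1.2.
pose x''_ k := (z_ k).1.1.2.
pose y_ k := (z_ k).1.2.
pose s_ k := (z_ k).2.1.
pose u_ k := (z_ k).2.2.
have {}z_stat k :
    [/\ [/\ ball xbar k.+1%:R^-1 (x_ k), ball xbar k.+1%:R^-1 (x'_ k) &
            ball xbar k.+1%:R^-1 (x''_ k)],
        ball 0 k.+1%:R^-1 (y_ k),
        (`|q (x_ k) - q xbar| < k.+1%:R^-1%:E)%E,
        frechet_sum q G K C (x_ k) (x'_ k) (x''_ k) (y_ k) (s_ k) &
        dual_ball k.+1%:R^-1 (u_ k) /\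
          forall h, 'd f (x_ k) h + s_ k h + u_ k h = 0].
  by move: (z_stat k); rewrite /x_ /x'_ /x''_ /y_ /s_ /u_;
    case: (z_ k) => [[[[x x'] x''] y] [s u]].
have x_cvg : x_ k @[k --> \oo] --> xbar.
  by apply: cvg_ball_natSinv => k; have [[]] := z_stat k.
exists x_, x'_, x''_, y_, s_; split.
- by split=> //; apply: cvg_ball_natSinv => k; have [[]] := z_stat k.
- by apply: cvg_ball_natSinv => k; have [] := z_stat k.
- have qxbar_fin : q xbar \is a fin_num.
    rewrite fin_numE; apply/andP; split; first exact/eqP/q_not_ninfty.
    by have [_] := xbar_feasible; rewrite /edom /= ltey.
  (* The value +oo is excluded because its distance to the finite [q xbar] would be +oo, not below
     1/(k+1). Convergence in the extended reals thus reduces to convergence of real values. *)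
  have qx_fin k : q (x_ k) \is a fin_num.
    have [_ _ + _ _] := z_stat k; move: qxbar_fin (q_not_ninfty (x_ k)).
    by case: (q xbar) (q (x_ k)) => [r| |] [t| |].
  have -> : (fun k => q (x_ k)) = (fun k => (fine (q (x_ k)))%:E).
    by apply/funext => k; rewrite fineK.
  rewrite -(fineK qxbar_fin); apply: cvg_EFin; first exact: nearW.
  apply: cvg_ball_natSinv => k; rewrite -ball_normE /ball_ /= distrC.
  have [_ _ + _ _] := z_stat k.
  by rewrite -(fineK qxbar_fin) -(fineK (qx_fin k)) -EFinB lte_fin.
- by move=> k; have [] := z_stat k.
have inv_cvg : k.+1%:R^-1 @[k --> \oo] --> (0 : R) by exact: cvg_harmonic.
have bound_cvg : op_norm ('d f (x_ k) \- 'd f xbar) + k.+1%:R^-1 @[k --> \oo]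
    --> (0 : R).
  rewrite -[0 in X in _ --> X]addr0; apply: cvgD inv_cvg.
  (* The limit in [df_cont] is over full neighbourhoods, so terms with [x_ k = xbar] do no harm. *)
  exact: (cvg_comp _ _ x_cvg (df_cont xbar)).
apply: (squeeze_cvgr _ (cvg_cst 0) bound_cvg); apply: nearW => k.
have [_ _ _ _ [[u_dual u_lt] sum0]] := z_stat k.
have d_dual : dual_space ('d f (x_ k) \- 'd f xbar : X -> R).
  exact: dual_spaceD (dual_spaceN _ (df_dual _)).
have s_eq h : (s_ k \- (\- ('d f xbar : X -> R))) h =
    - (('d f (x_ k) h - 'd f xbar h) + u_ k h).
  by apply/eqP; rewrite -subr_eq0 /= -[X in _ == X](sum0 h); apply/eqP; ring.
(* The lower bound 0 requires a continuous linear functional; the identity [s_eq] exhibits the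
   difference as one, being built from ['d f] and [u_ k]. *)
apply/andP; split.
  rewrite (_ : _ \- _ = \- (('d f (x_ k) \- 'd f xbar) \+ u_ k)).
    by apply: op_norm_ge0; apply: dual_spaceN; exact: dual_spaceD.
  by apply/funext => h; exact: s_eq.
(* The triangle inequality is applied pointwise on the unit ball, and each summand is then bounded
   by its own operator norm. *)
apply: op_norm_le => h h1; rewrite s_eq normrN.
apply: le_trans (ler_normD _ _) _; apply: lerD.
  exact: ler_op_norm d_dual h1.
by apply: le_trans (ltW u_lt); exact: ler_op_norm u_dual h1.
Qed.
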